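(* There is an algorithm that, given a string $S[1..n]$ over the alphabet $\{1,2,\dots,n\}$ and an integer $k>1$, determines the locations (starting and ending positions) of all substrings of $S$ that are anti-powers of order $k$ in $O(n^2/k)$ time and $O(n)$ space.
   Context: For a string $S=S[1..n]$, $S[i..j]$ denotes the substring $S[i]S[i+1]\cdots S[j]$. An anti-power of order $k$ (a $k$-anti-power) is a string that can be written as a concatenation of $k$ pairwise-distinct strings all of the same length (its anti-period). The complexity is measured in the standard word-RAM model. *)

(* Defs.v *)
From mathcomp Require Import all_boot.

Set Implicit Arguments.
Unset Strict Implicit.
Unset Printing Implicit Defensive.

Section Strings.
Variable A : eqType.
Implicit Types (S u : seq A) (i j k : nat).

(** [S[i..j]], with 1-based positions and both ends included. *)
Definition substring S i j : seq A := drop i.-1 (take j S).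

Definition anti_power k u : Prop :=
  exists2 blocks : seq (seq A), u = flatten blocks &
    [/\ size blocks = k, uniq blocks
      & exists m, all (fun b => size b == m) blocks].

Definition anti_power_at k S i j : Prop :=
  1 <= i <= j /\ j <= size S /\ anti_power k (substring S i j).

End Strings.

(** Word RAM with [w]-bit words.  A program is a fixed finite list of
    instructions, so it names only finitely many registers; every instruction
    costs one unit of time. *)

Definition reg := nat.

Inductive binop :=
  | Add | Sub | Mul | Div | Mod | And | Or | Xor | Shl | Shr.

Inductive instr :=
  | Const of reg & nat
  | Move of reg & reg
  | Bin of binop & reg & reg & reg    (* operation, destination, operands *)
  | Read of reg & reg                 (* destination, address register *)
  | Write of reg & reg                (* address register, source *)
  | Jump of nat
  | JumpEq of reg & reg & nat
  | JumpLt of reg & reg & nat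
  | Out of reg
  | Halt.

Definition program := seq instr.

(** [output] is a write-only stream, in order of emission; it is not part of
    the addressable memory. *)
Record state := State {
  pc : nat;
  regs : reg -> nat;
  mem : nat -> nat;
  output : seq nat
}.

(** All results are reduced modulo [2 ^ w]; in particular subtraction wraps
    around.  Division by zero yields 0, and [x mod 0] is [x]. *)
Definition eval_binop (w : nat) (o : binop) (x y : nat) : nat :=
  match o with
  | Add => x + y
  | Sub => x + 2 ^ w - y
  | Mul => x * y
  | Div => x %/ y
  | Mod => x %% y
  | And => Nat.land x y
  | Or => Nat.lor x y
  | Xor => Nat.lxor x y
  | Shl => x * 2 ^ y
  | Shr => x %/ 2 ^ y
  end %% 2 ^ w.

(** A program counter outside the program means that the machine has halted. *)
Definition fetch (P : program) (s : state) : instr := nth Halt P (pc s).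

Definition halted (P : program) (s : state) : bool :=
  if fetch P s is Halt then true else false.

Definition set_reg (s : state) (r : reg) (x : nat) : state :=
  State (pc s).+1 [eta regs s with r |-> x] (mem s) (output s).

Definition goto (s : state) (l : nat) : state :=
  State l (regs s) (mem s) (output s).

(** Halted states are fixed points of [step]. *)
Definition step (w : nat) (P : program) (s : state) : state :=
  match fetch P s with
  | Const d c => set_reg s d (c %% 2 ^ w)
  | Move d a => set_reg s d (regs s a)
  | Bin o d a b => set_reg s d (eval_binop w o (regs s a) (regs s b))
  | Read d a => set_reg s d (mem s (regs s a))
  | Write a b =>
      State (pc s).+1 (regs s) [eta mem s with regs s a |-> regs s b] (output s)
  | Jump l => goto s l
  | JumpEq a b l => goto s (if regs s a == regs s b then l else (pc s).+1)
  | JumpLt a b l => goto s (if regs s a < regs s b then l else (pc s).+1)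
  | Out a => State (pc s).+1 (regs s) (mem s) (rcons (output s) (regs s a))
  | Halt => s
  end.

Definition run (w : nat) (P : program) (s : state) (t : nat) : state :=
  iter t (step w P) s.

(** One more than the address accessed by the next instruction, 0 if that
    instruction does not access the memory. *)
Definition footprint (P : program) (s : state) : nat :=
  match fetch P s with
  | Read _ a | Write a _ => (regs s a).+1
  | _ => 0
  end.

(** The number of words in the shortest initial segment of the memory that
    contains every cell read or written during the first [t] steps. *)
Definition space (w : nat) (P : program) (s : state) (t : nat) : nat :=
  \max_(t' < t) footprint P (run w P s t').

(** [n] and [k] are in registers 0 and 1, the letter [S[i]] is in the memory
    cell of address [i - 1], and everything else is 0. *)
Definition initial (n k : nat) (S : seq nat) : state :=
  State 0 (nth 0 [:: n; k]) (nth 0 S) [::].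

(** A list of locations as a stream of words: start, end, start, end, ... *)
Definition encode (locs : seq (nat * nat)) : seq nat :=
  flatten [seq [:: l.1; l.2] | l <- locs].

(* Main.v *)
Require Import Defs.
From Stdlib Require Import FunctionalExtensionality.
From mathcomp Require Import all_boot zify.

(** For each length [L <= n / k], the algorithm spends O(n) time.

    Naming: every position [i] gets a number, at most [n], such that two
    positions get the same number iff the factors of length [L] starting there
    are equal.  A factor of length [L] is determined by the name of its prefix
    of length [L - 1] and by its last letter.  Visiting the positions letter by
    letter (the occurrences of each letter are linked in a list once and for
    all), it suffices to remember, for each name of the prefix, one
    representative position, which serves as the new name.

    Scanning: the blocks of an anti-power of anti-period [L] start in one
    residue class modulo [L].  Along each class, a table with the latest
    occurrence of each name maintains the start of the longest window of
    pairwise distinct blocks, and an anti-power is reported whenever this window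
    has at least [k] blocks.

    Neither table is ever reset.  An entry is only trusted after comparing the
    name (and letter, or residue) of the position that it holds with the
    expected one: a stale representative that passes the test is still a correct
    one, and a stale latest occurrence never passes it. *)

Set Implicit Arguments.
Unset Strict Implicit.
Unset Printing Implicit Defensive.

(** * Anti-powers as families of factors at equal offsets *)

Section Factors.
Variables (A : eqType).
Implicit Types (S : seq A).

Definition factor S L x := take L (drop x S).

Lemma size_factor S L x : x + L <= size S -> size (factor S L x) = L.
Proof. by move=> h; rewrite size_takel // size_drop; lia. Qed.

Lemma factorS a0 S L x : x + L < size S ->
  factor S L.+1 x = rcons (factor S L x) (nth a0 S (x + L)).
Proof.
move=> h; rewrite /factor (take_nth a0) ?nth_drop //.
by rewrite size_drop; lia.
Qed.

Lemma flatten_factors S L x k : x + k * L <= size S ->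
  flatten (mkseq (fun s => factor S L (x + s * L)) k) = factor S (k * L) x.
Proof.
elim: k => [|k IHk] h; first by rewrite /factor take0.
rewrite mkseqS -cats1 flatten_cat IHk /=; last by lia.
by rewrite cats0 mulSnr /factor takeD drop_drop (addnC x).
Qed.

Lemma nth_blocks (bs : seq (seq A)) m s : all (fun b => size b == m) bs ->
  s < size bs -> nth [::] bs s = take m (drop (s * m) (flatten bs)).
Proof.
elim: bs s => [|b bs IHbs] [|s] //= /andP[/eqP sb abs] ls.
  by rewrite drop0 -sb take_size_cat.
by rewrite IHbs // mulSn -sb addnC -drop_drop drop_size_cat.
Qed.

(** Block [s] of a decomposition with anti-period [L] is the factor at [x + s * L], where [x] is the
    0-based start. The condition [i <= j] excludes the empty substring, hence [L > 0]. *)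
Lemma anti_power_atP k S i j : 1 < k -> anti_power_at k S i j <->
  exists L x, [/\ 0 < L, i = x.+1, j = x + k * L, j <= size S &
    forall s t, s < t < k -> factor S L (x + s * L) != factor S L (x + t * L)].
Proof.
move=> k1; split.
  case=> /andP[i0 xj] [jS [bs ebs [sbs ubs [m am]]]].
  case: i i0 xj ebs => // x _ xj ebs.
  have szf : size (flatten bs) = k * m.
    rewrite size_flatten /shape -sbs.
    elim: (bs) am => //= b l IH /andP[/eqP-> /IH->].
    by rewrite mulSn.
  have szs : j - x = k * m.
    by rewrite -szf -ebs /substring /= size_drop size_takel.
  have nthE s : s < k -> nth [::] bs s = factor S m (x + s * m).
    move=> sk; rewrite (nth_blocks am) ?sbs //.
    rewrite -ebs /substring /= drop_drop /factor.
    have sm : s.+1 * m <= k * m by rewrite leq_mul2r sk orbT.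
    rewrite !take_drop take_takel // addnC ?(addnC x) //.
    by rewrite mulSn in sm; lia.
  exists m, x; split=> //; [|by rewrite -szs; lia|].
    by case: (posnP m) szs => // ->; rewrite muln0 /=; lia.
  move=> s t /andP[st tk]; have sk := ltn_trans st tk.
  by rewrite -!nthE // nth_uniq ?sbs // neq_ltn st.
move=> [L [x [L0 -> -> jS D]]]; split; last split=> //.
  by have : 1 * 1 <= k * L by [apply: leq_mul; lia]; lia.
exists (mkseq (fun s => factor S L (x + s * L)) k).
  by rewrite flatten_factors // /substring /= addnC -take_drop.
split; first by rewrite size_mkseq.
  apply/mkseq_uniqP => s t; rewrite !inE => sk tk /eqP.
  case: (ltngtP s t) => // st; [|rewrite eq_sym];
    by rewrite (negbTE (D _ _ _)) ?st ?sk ?tk.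
exists L; apply/allP=> b /mapP[s]; rewrite mem_iota /= => sk ->.
rewrite size_factor //; have : s.+1 * L <= k * L by rewrite leq_mul2r orbC sk.
by rewrite mulSn; lia.
Qed.

End Factors.

(** * The program *)

(* Registers 12 to 19 are local variables.  In [refine_code] they hold the
   letter, the list cell (one more than the position of the letter, 0 at the end
   of the list), the start of the factor, the name of its prefix, an address,
   the representative, and scratch values; in [scan_code] the residue, the
   position, the start of the window, the end of the block, its name, and
   scratch values. *)
Local Notation Rn := 0 (only parsing).
Local Notation Rk := 1 (only parsing).
Local Notation Rone := 2 (only parsing).
Local Notation Rhead := 3 (only parsing).
Local Notation Rnext := 4 (only parsing).
Local Notation Rname := 5 (only parsing).
Local Notation Rname' := 6 (only parsing).
Local Notation Rrep := 7 (only parsing).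
Local Notation Rlast := 8 (only parsing).
Local Notation Rzero := 9 (only parsing).
Local Notation Rlen := 10 (only parsing).
Local Notation Rklen := 11 (only parsing).
(* Jump targets are absolute indices into [antipower_prog].  A conditional jump
   over the unconditional jump that follows it encodes a jump on the negated
   condition. *)
Local Notation Lbuild := 8 (only parsing).
Local Notation Llen := 17 (only parsing).
Local Notation Lrefine := 22 (only parsing).
Local Notation Lfresh := 38 (only parsing).
Local Notation Lset := 40 (only parsing).
Local Notation Lskip := 42 (only parsing).
Local Notation Lletter := 45 (only parsing).
Local Notation Lscan := 50 (only parsing).
Local Notation Lpos := 53 (only parsing).
Local Notation Ltest := 74 (only parsing).
Local Notation Lnext := 80 (only parsing).
Local Notation Lresidue := 82 (only parsing).
Local Notation Lend := 87 (only parsing).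

(** All tables have [n + 1] cells, as letters, list cells and names range up to [n]. *)
Definition setup_code : program := [::
  JumpLt Rn Rk Lend;
  Const Rone 1;
  Bin Add Rhead Rn Rone;
  Bin Add Rnext Rhead Rhead;
  Bin Add Rname Rnext Rhead;
  Bin Add Rname' Rname Rhead;
  Bin Add Rrep Rname' Rhead;
  Bin Add Rlast Rrep Rhead].

Definition build_code : program := [::
  JumpEq 13 Rn Llen;
  Read 14 13;
  Bin Add 15 Rhead 14;
  Read 16 15;
  Bin Add 13 13 Rone;
  Write 15 13;
  Bin Add 15 Rnext 13;
  Write 15 16;
  Jump Lbuild].

Definition length_code : program := [::
  Bin Add Rlen Rlen Rone;
  Bin Add Rklen Rklen Rk;
  JumpLt Rn Rklen Lend;
  Move 12 Rzero;
  Move 13 Rzero].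

(** A list cell [q] stands for the factor whose last letter is at position [q - 1]: it starts at [q]
    minus the length, and cells below the length are skipped. *)
Definition refine_code : program := [::
  JumpEq 13 Rzero Lletter;
  JumpLt 13 Rlen Lskip;
  Bin Defs.Sub 14 13 Rlen;
  Bin Add 15 Rname 14;
  Read 15 15;
  Bin Add 16 Rrep 15;
  Read 17 16;
  Bin Add 18 17 Rlen;
  JumpLt Rn 18 Lfresh;
  Bin Defs.Sub 18 18 Rone;
  Read 18 18;
  JumpEq 18 12 35;
  Jump Lfresh;
  Bin Add 18 Rname 17;
  Read 18 18;
  JumpEq 18 15 Lset;
  Write 16 14;
  Move 17 14;
  Bin Add 18 Rname' 14;
  Write 18 17;
  Bin Add 18 Rnext 13;
  Read 13 18;
  Jump Lrefine;
  Bin Add 12 12 Rone;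
  JumpLt Rn 12 Lscan;
  Bin Add 18 Rhead 12;
  Read 13 18;
  Jump Lrefine].

(** Each visited position has its new name copied over the old one, so that the old array is ready
    for the next length. *)
Definition scan_code : program := [::
  Move 12 Rzero;
  Move 13 Rzero;
  Move 14 Rzero;
  Bin Add 15 13 Rlen;
  JumpLt Rn 15 Lresidue;
  Bin Add 16 Rname' 13;
  Read 16 16;
  Bin Add 17 Rname 13;
  Write 17 16;
  Bin Add 17 Rlast 16;
  Read 18 17;
  Write 17 13;
  JumpLt 18 13 64;
  Jump Ltest;
  Bin Mod 19 18 Rlen;
  JumpEq 19 12 67;
  Jump Ltest;
  Bin Add 19 Rname 18;
  Read 19 19;
  JumpEq 19 16 71;
  Jump Ltest;
  Bin Add 18 18 Rlen;
  JumpLt 18 14 Ltest;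
  Move 14 18;
  Bin Add 18 14 Rklen;
  JumpLt 15 18 Lnext;
  Bin Defs.Sub 18 15 Rklen;
  Bin Add 18 18 Rone;
  Out 18;
  Out 15;
  Move 13 15;
  Jump Lpos;
  Bin Add 12 12 Rone;
  JumpEq 12 Rlen Llen;
  Move 13 12;
  Move 14 12;
  Jump Lpos;
  Halt].

Definition antipower_prog : program :=
  setup_code ++ build_code ++ length_code ++ refine_code ++ scan_code.

(** * Symbolic execution *)

Section Reach.
Variables (w B : nat).
Local Notation prog := antipower_prog.

(* [Q] is reached within [b] steps, which only access addresses below [B]. *)
Definition reach b s (Q : state -> Prop) := exists2 t, t <= b &
  (forall t', t' < t -> footprint prog (run w prog s t') <= B)
  /\ Q (run w prog s t).

Lemma reach_done b s (Q : state -> Prop) : Q s -> reach b s Q.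
Proof. by exists 0. Qed.

Lemma reach_le b' b s Q : reach b' s Q -> b' <= b -> reach b s Q.
Proof. by case=> t tb ? bb; exists t; rewrite // (leq_trans tb). Qed.

Lemma reach_step b s Q : footprint prog s <= B ->
  reach b (step w prog s) Q -> reach b.+1 s Q.
Proof.
move=> fB [t tb [ft Qt]]; exists t.+1 => //; split; last by rewrite /run iterSr.
by case=> // t'; rewrite ltnS /run iterSr; exact: ft.
Qed.

Section Conf.
Variable N : nat.
Hypothesis N0 : 0 < N.

(* Array number [c], of size [N], starts at the address [c * N]. *)
Definition conf l rs (As : seq (nat -> nat)) o := State l (nth 0 rs)
  (fun a => nth (fun=> 0) As (a %/ N) (a %% N)) o.

Variables (b l : nat) (rs : seq nat) (As : seq (nat -> nat)) (o : seq nat).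
Variable Q : state -> Prop.
Local Notation R := (nth 0 rs).
Local Notation set_r d v := (set_nth 0 rs d v).
Local Notation is_at i := (nth Halt prog l = i).

Lemma set_reg_conf d v :
  set_reg (conf l rs As o) d v = conf l.+1 (set_r d v) As o.
Proof.
congr State; apply: functional_extensionality => r.
by rewrite nth_set_nth.
Qed.

Let footprint_conf i : is_at i ->
  footprint prog (conf l rs As o) =
  if i is Read _ a then (R a).+1 else if i is Write a _ then (R a).+1 else 0.
Proof. by move=> fi; rewrite /footprint /fetch /= fi; case: i fi. Qed.

Lemma reach_const d c : is_at (Const d c) -> c < 2 ^ w ->
  reach b (conf l.+1 (set_r d c) As o) Q -> reach b.+1 (conf l rs As o) Q.
Proof.
move=> fi cw h; apply: reach_step; rewrite ?(footprint_conf fi) //.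
by rewrite /step /fetch /= fi set_reg_conf modn_small.
Qed.

Lemma reach_move d a : is_at (Move d a) ->
  reach b (conf l.+1 (set_r d (R a)) As o) Q -> reach b.+1 (conf l rs As o) Q.
Proof.
move=> fi h; apply: reach_step; rewrite ?(footprint_conf fi) //.
by rewrite /step /fetch /= fi set_reg_conf.
Qed.

Lemma reach_add d x y : is_at (Bin Add d x y) -> R x + R y < 2 ^ w ->
  reach b (conf l.+1 (set_r d (R x + R y)) As o) Q ->
  reach b.+1 (conf l rs As o) Q.
Proof.
move=> fi bw h; apply: reach_step; rewrite ?(footprint_conf fi) //.
by rewrite /step /fetch /= fi set_reg_conf /eval_binop modn_small.
Qed.

Lemma reach_sub d x y : is_at (Bin Defs.Sub d x y) -> R y <= R x < 2 ^ w ->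
  reach b (conf l.+1 (set_r d (R x - R y)) As o) Q ->
  reach b.+1 (conf l rs As o) Q.
Proof.
move=> fi /andP[yx xw] h; apply: reach_step; rewrite ?(footprint_conf fi) //.
rewrite /step /fetch /= fi set_reg_conf /eval_binop.
rewrite -addnBAC // modnDr modn_small //.
exact: leq_ltn_trans (leq_subr _ _) xw.
Qed.

Lemma reach_mod d x y : is_at (Bin Mod d x y) -> R x < 2 ^ w ->
  reach b (conf l.+1 (set_r d (R x %% R y)) As o) Q ->
  reach b.+1 (conf l rs As o) Q.
Proof.
move=> fi xw h; apply: reach_step; rewrite ?(footprint_conf fi) //.
rewrite /step /fetch /= fi set_reg_conf /eval_binop modn_small //.
exact: leq_ltn_trans (leq_mod _ _) xw.
Qed.

Lemma reach_read c x d a : is_at (Read d a) -> R a = c * N + x -> x < N ->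
  c * N + x < B ->
  reach b (conf l.+1 (set_r d (nth (fun=> 0) As c x)) As o) Q ->
  reach b.+1 (conf l rs As o) Q.
Proof.
move=> fi Ra xN cB h; apply: reach_step; rewrite ?(footprint_conf fi) ?Ra //.
rewrite /step /fetch /= fi set_reg_conf /= Ra divnMDl // modnMDl.
by rewrite divn_small // addn0 modn_small.
Qed.

Lemma reach_write c x a y : is_at (Write a y) -> R a = c * N + x -> x < N ->
  c * N + x < B ->
  reach b (conf l.+1 rs (set_nth (fun=> 0) As c
    [eta nth (fun=> 0) As c with x |-> R y]) o) Q ->
  reach b.+1 (conf l rs As o) Q.
Proof.
move=> fi Ra xN cB h; apply: reach_step; rewrite ?(footprint_conf fi) ?Ra //.
rewrite /step /fetch /= fi Ra; congr (reach b _ Q): h.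
congr State; apply: functional_extensionality => p /=.
(* Quotient and remainder by [N] determine the table and the index, so a write changes one entry of
   one table. *)
have -> : (p == c * N + x) = (p %/ N == c) && (p %% N == x).
  apply/eqP/andP => [->|[/eqP <- /eqP <-]]; last exact: divn_eq.
  by rewrite divnMDl // modnMDl divn_small // addn0 modn_small // !eqxx.
by rewrite nth_set_nth /=; case: eqP => [->|].
Qed.

Lemma reach_jump l' : is_at (Jump l') ->
  reach b (conf l' rs As o) Q -> reach b.+1 (conf l rs As o) Q.
Proof.
move=> fi h; apply: reach_step; rewrite ?(footprint_conf fi) //.
by rewrite /step /fetch /= fi.
Qed.

Lemma reach_jumpeq x y l' : is_at (JumpEq x y l') ->
  reach b (conf (if R x == R y then l' else l.+1) rs As o) Q ->
  reach b.+1 (conf l rs As o) Q.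
Proof.
move=> fi h; apply: reach_step; rewrite ?(footprint_conf fi) //.
by rewrite /step /fetch /= fi.
Qed.

Lemma reach_jumplt x y l' : is_at (JumpLt x y l') ->
  reach b (conf (if R x < R y then l' else l.+1) rs As o) Q ->
  reach b.+1 (conf l rs As o) Q.
Proof.
move=> fi h; apply: reach_step; rewrite ?(footprint_conf fi) //.
by rewrite /step /fetch /= fi.
Qed.

Lemma reach_out x : is_at (Out x) ->
  reach b (conf l.+1 rs As (rcons o (R x))) Q -> reach b.+1 (conf l rs As o) Q.
Proof.
move=> fi h; apply: reach_step; rewrite ?(footprint_conf fi) //.
by rewrite /step /fetch /= fi.
Qed.

End Conf.
End Reach.

(** * Correctness *)

Section Machine.
Variables (n k w : nat) (S : seq nat).
Hypotheses (size_S : size S = n) (S_letters : forall a, a \in S -> 1 <= a <= n).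
Hypotheses (k_gt1 : 1 < k) (k_le_n : k <= n) (word_size : 16 * n <= 2 ^ w).

Local Notation N := n.+1.
Local Notation B := (14 * n).
Local Notation reach := (reach w B).
Local Notation letter := (nth 0 S).
(* [hd] and [nx] are the lists of occurrences, [nm] and [nw] the names for the
   previous and the current length, [tb] the representatives, and [ls] the latest
   occurrences. *)
Local Notation mach l len x y t14 t15 t16 t17 t18 t19 hd nx nm nw tb ls o :=
  (conf N l
    [:: n; k; 1; 1 * N; 2 * N; 3 * N; 4 * N; 5 * N; 6 * N; 0; len; len * k;
        x; y; t14; t15; t16; t17; t18; t19]
    [:: letter; hd; nx; nm; nw; tb; ls] o).

Let letter_le p : letter p <= n.
Proof.
case: (ltnP p n) => pn; last by rewrite nth_default // size_S.
by have /S_letters/andP[] : letter p \in S by rewrite mem_nth // size_S.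
Qed.

(* One more than the last position below [q] of the letter [c], 0 if none. *)
Fixpoint last_occ (c q : nat) : nat :=
  if q is p.+1 then if letter p == c then q else last_occ c p else 0.

Lemma last_occ_le c q : last_occ c q <= q.
Proof. by elim: q => //= q IH; case: ifP => // _; exact: leqW. Qed.

Ltac bound := cbn [nth]; lia.
Ltac next := cbn [nth set_nth].
Ltac budget b := apply: (@reach_le _ _ b); last by lia.

Ltac add := apply: reach_add; [reflexivity|bound|next].
Ltac sub := apply: reach_sub; [reflexivity|bound|next].
Ltac move_reg := apply: reach_move; [reflexivity|next].
Ltac jump := apply: reach_jump; [reflexivity|next].
Ltac jumpeq := apply: reach_jumpeq; [reflexivity|next].
Ltac jumplt := apply: reach_jumplt; [reflexivity|next].
Ltac read :=
  apply: reach_read; [by []|reflexivity|reflexivity|bound|bound|next].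
Ltac read_at c x :=
  apply: (reach_read (ltn0Sn n) (c := c) (x := x));
  [reflexivity|reflexivity|bound|bound|next].
Ltac write :=
  apply: reach_write; [by []|reflexivity|reflexivity|bound|bound|next].
Ltac output := apply: reach_out; [reflexivity|next].

(** * Linked lists of the occurrences of each letter *)

Definition lists_upto q (hd nx : nat -> nat) :=
  (forall c : nat, hd c = last_occ c q) /\
  (forall p, p < q -> nx p.+1 = last_occ (letter p) p).

(** The rest of the run is a continuation with budget [b]; a position takes nine steps and the exit
    one. *)
Lemma build_loop b Q x q t14 t15 t16 t17 t18 t19 hd nx nm nw tb ls o : q <= n ->
  lists_upto q hd nx ->
  (forall hd nx y t14 t15 t16, lists_upto n hd nx ->
     reach b (mach Llen 0 x y t14 t15 t16 t17 t18 t19 hd nx nm nw tb ls o) Q) ->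
  reach ((n - q) * 9 + 1 + b)
    (mach Lbuild 0 x q t14 t15 t16 t17 t18 t19 hd nx nm nw tb ls o) Q.
Proof.
move=> qn lq K; have [m Em] := ubnP (n - q).
elim: m q t14 t15 t16 hd nx Em qn lq => // m IHm q t14 t15 t16 hd nx Em qn lq.
case: (eqVneq q n) => [qEn | qNn].
  budget (1 + b); by jumpeq; rewrite qEn eqxx; apply: K; rewrite -qEn.
have {qNn} qn' : q < n by rewrite ltn_neqAle qNn.
have lqn := letter_le q.
have hdn c : hd c <= n by rewrite lq.1 (leq_trans (last_occ_le _ _)).
budget (9 + ((n - q.+1) * 9 + 1 + b)).
jumpeq; rewrite (ltn_eqF qn').
read_at 0 q.
add.
read.
add.
write.
add.
write.
jump.
rewrite (addn1 q); apply: IHm => //; first lia.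
split=> [c|p] /=; rewrite ?lq.1.
  by rewrite eq_sym.
rewrite eqSS ltnS leq_eqVlt; by case: eqP => [->|_ /= /lq.2].
Qed.

Lemma last_occ_max c q p : p < q -> letter p = c -> p < last_occ c q.
Proof.
elim: q => //= q IH; rewrite ltnS leq_eqVlt => /orP[/eqP-> ->|/IH h lp].
  by rewrite eqxx.
by case: ifP => _; [rewrite (leq_trans (h lp)) // leqW // last_occ_le | exact: h].
Qed.

Lemma letter_last_occ c q p : last_occ c q = p.+1 -> letter p = c.
Proof. by elim: q => //= q IH; case: eqP => // lq [<-]. Qed.

Let count_take (c q : nat) : q < n ->
  count_mem c (take q.+1 S) = count_mem c (take q S) + (letter q == c).
Proof.
by move=> qn; rewrite (take_nth 0) ?size_S // -cats1 count_cat /= addn0.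
Qed.

Lemma count_last_occ c q : q <= n ->
  count_mem c (take (last_occ c q) S) = count_mem c (take q S).
Proof.
elim: q => //= q IH qn; case: ifP => // lq.
by rewrite IH ?count_take ?lq ?addn0 // ltnW.
Qed.

(** * Naming the factors of length [m + 1] from those of length [m] *)

Definition names m (nm : nat -> nat) := forall i j, i + m <= n -> j + m <= n ->
  (nm i == nm j) = (factor S m i == factor S m j).

Definition bounded (f : nat -> nat) := forall x, f x <= n.

Let bounded_upd f (i x : nat) : bounded f -> x <= n ->
  bounded [eta f with i |-> x].
Proof. by move=> fn xn y /=; case: ifP. Qed.

(* The positions that precede, in the traversal, the list cell [q] of [c]. *)
Definition visited (c q p : nat) :=
  (letter p < c) || ((letter p == c) && (q <= p)).

Lemma visited_last_occ c p x : letter p = c ->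
  visited c (last_occ c p) x = visited c p.+1 x || (x == p).
Proof.
move=> lp; rewrite /visited; case: (eqVneq x p) => [->|xp].
  by rewrite lp eqxx last_occ_le !orbT.
rewrite orbF; case: eqP => //= lx; rewrite lx ltnn /=.
case: (ltngtP x p) xp => // xp _; first by rewrite leqNgt last_occ_max.
by rewrite (leq_trans (last_occ_le _ _)) // ltnW.
Qed.

Lemma visitedS c x : x < n -> visited c.+1 (last_occ c.+1 n) x = visited c 0 x.
Proof.
move=> xn; rewrite /visited andbT ltnS leq_eqVlt.
case: (eqVneq (letter x) c.+1) => [lx|_] /=; last by rewrite orbF orbC.
by rewrite [last_occ _ _ <= x]leqNgt last_occ_max // orbF orbC.
Qed.

(** The factor of length [m + 1] at [i] is visited through its last position [i + m]. A new name is
    itself the start of an equal factor. The table [tb] is claimed right for the current letter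
    only; entries left by earlier letters may be stale. *)
Record refining m (nm : nat -> nat) (c q : nat) (nw tb : nat -> nat) : Prop :=
    Refining {
  refining_sound : forall i, i + m < n -> visited c q (i + m) ->
    nw i + m < n /\ factor S m.+1 (nw i) = factor S m.+1 i;
  refining_complete : forall i j, i + m < n -> j + m < n ->
    visited c q (i + m) -> visited c q (j + m) ->
    factor S m.+1 i = factor S m.+1 j -> nw i = nw j;
  refining_rep : forall i, i + m < n -> visited c q (i + m) ->
    letter (i + m) = c -> tb (nm i) = nw i
}.

Lemma refining_start m nm nw tb : refining m nm 0 0 nw tb.
Proof.
have no p : p < n -> ~~ visited 0 0 p.
  move=> pn; have /S_letters : letter p \in S by rewrite mem_nth // size_S.
  by rewrite /visited; case: (letter p).
split=> [i im v|i j im _ v|i im v]; have := no _ im; by rewrite v.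
Qed.

Lemma refining_ext m nm c q c' q' nw tb :
  (forall p, m <= p < n -> visited c' q' p -> visited c q p) ->
  (forall i, i + m < n -> visited c' q' (i + m) -> letter (i + m) = c' ->
    c = c') ->
  refining m nm c q nw tb -> refining m nm c' q' nw tb.
Proof.
move=> vv cc [Hs Hc Hr]; have {}vv i : i + m < n -> visited c' q' (i + m) ->
    visited c q (i + m) by move=> im; apply: vv; rewrite leq_addl.
split=> [i im v|i j im jm vi vj|i im v l].
- exact/Hs/vv.
- by apply: Hc => //; exact: vv.
- by apply: Hr => //; [exact: vv | rewrite (cc i)].
Qed.

Lemma refining_letter m nm c nw tb :
  refining m nm c 0 nw tb -> refining m nm c.+1 (last_occ c.+1 n) nw tb.
Proof.
apply: refining_ext => [p /andP[_ pn]|i im]; first by rewrite visitedS.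
by rewrite visitedS // /visited andbT => /orP[] h lc; move: h; rewrite lc; lia.
Qed.

Lemma factorS_eq m i j : i + m < n -> j + m < n ->
  (factor S m.+1 i == factor S m.+1 j) =
  (factor S m i == factor S m j) && (letter (i + m) == letter (j + m)).
Proof. by move=> im jm; rewrite !(factorS 0) ?size_S // eqseq_rcons. Qed.

(** A candidate [j] that passes [ok] has the right prefix and last letter, even if it is a stale
    entry. If it fails, no visited factor equals the one at [i], since that factor would have left
    its name in [tb]; so [i] represents itself. *)
Lemma refining_step m nm i nw tb (c := letter (i + m)) (j := tb (nm i)) 
    (ok := [&& j + m < n, letter (j + m) == c & nm j == nm i]) :
  names m nm -> i + m < n -> refining m nm c (i + m).+1 nw tb ->
  refining m nm c (last_occ c (i + m))
    [eta nw with i |-> if ok then j else i]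
    (if ok then tb else [eta tb with nm i |-> i]).
Proof.
move=> nmP im [Hs Hc Hr].
have vis x : x + m < n -> visited c (last_occ c (i + m)) (x + m) ->
    x != i -> visited c (i + m).+1 (x + m).
  by move=> xm; rewrite visited_last_occ // eqn_add2r => /orP[//|->].
have key x : x + m < n -> x != i -> visited c (last_occ c (i + m)) (x + m) ->
    letter (x + m) = c -> nm x = nm i -> ok /\ nw x = j.
  move=> xm xi /vis vx lx nx; have {}vx := vx xm xi.
  have [nwm nwE] := Hs x xm vx; have tbE := Hr x xm vx lx.
  have jE : j = nw x by rewrite /j -nx.
  split=> //; rewrite /ok jE nwm /=.
  move/eqP: nwE; rewrite factorS_eq // lx => /andP[nwE ->] /=.
  by rewrite -nx nmP // ltnW.
have keyf x : x + m < n -> x != i -> visited c (last_occ c (i + m)) (x + m) ->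
    factor S m.+1 x = factor S m.+1 i -> ok /\ nw x = j.
  move=> xm xi vx /eqP; rewrite factorS_eq // => /andP[fx /eqP lx].
  by apply: key => //; apply/eqP; rewrite nmP // ltnW.
split=> [x xm|x y xm ym|x xm] /=.
- case: (eqVneq x i) => [-> _|xi /vis vx]; last exact: Hs x xm (vx xm xi).
  case: ifP => // /and3P[jm lj nj]; split=> //.
  by apply/eqP; rewrite factorS_eq // -nmP ?nj ?lj // ltnW.
- case: (eqVneq x i) => [->|xi]; case: (eqVneq y i) => [->|yi] // vx vy.
  + by move/esym/(keyf y ym yi vy) => [-> ->].
  + by move/(keyf x xm xi vx) => [-> ->].
  + by apply: Hc => //; exact: vis.
- case: (eqVneq x i) => [->|xi] vx lx; first by case: ifP => //=; rewrite eqxx.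
  case: ifP => okE; first exact: Hr x xm (vis x xm vx xi) lx.
  rewrite /=; case: eqP => [nx|_]; last exact: Hr x xm (vis x xm vx xi) lx.
  by have [] := key x xm xi vx lx nx; rewrite okE.
Qed.

(** Every position is now visited, and a common name is the start of a factor equal to both. *)
Lemma refining_end m nm nw tb : refining m nm n 0 nw tb -> names m.+1 nw.
Proof.
case=> Hs Hc _ i j; rewrite !addnS => im jm.
have vis p : visited n 0 p by rewrite /visited andbT orbC -leq_eqVlt letter_le.
apply/eqP/eqP => [e|]; last exact: Hc.
by have [_ <-] := Hs i im (vis _); have [_ <-] := Hs j jm (vis _); rewrite e.
Qed.

(* The number of list cells still to be visited, plus that of letters. *)
Let potential c q :=
  count (fun a => c < a) S + count_mem c (take q S) + (n - c).

Lemma potential_letter c : c < n ->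
  potential c 0 = (potential c.+1 (last_occ c.+1 n)).+1.
Proof.
move=> cn; rewrite /potential count_last_occ // take0 take_oversize ?size_S //=.
have -> : count (fun a => c < a) S =
    count (fun a => c.+1 < a) S + count_mem c.+1 S.
  by elim: (S) => //= a s ->; lia.
by rewrite addn0 -addnS subnSK.
Qed.

Lemma potential_next p (c := letter p) : p < n ->
  potential c p.+1 = (potential c (last_occ c p)).+1.
Proof.
move=> pn; rewrite /potential count_last_occ; last exact: ltnW.
by rewrite count_take // eqxx; lia.
Qed.

Lemma refine_loop b Q m c q t14 t15 t16 t17 t18 t19 hd nx nm nw tb ls o :
  c <= n -> q <= n -> (forall p, q = p.+1 -> letter p = c) -> m < n ->
  lists_upto n hd nx -> names m nm ->
  bounded nm -> bounded nw -> bounded tb ->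
  refining m nm c q nw tb ->
  (forall nw tb x y t14 t15 t16 t17 t18 t19,
     names m.+1 nw -> bounded nw -> bounded tb ->
     reach b (mach Lscan m.+1 x y t14 t15 t16 t17 t18 t19
                hd nx nm nw tb ls o) Q) ->
  reach (potential c q * 23 + 3 + b)
    (mach Lrefine m.+1 c q t14 t15 t16 t17 t18 t19 hd nx nm nw tb ls o) Q.
Proof.
move=> cn qn qc mn [hdP nxP] nmP nmb nwb tbb inv K.
have [f Ef] := ubnP (potential c q).
elim: f c q nw tb t14 t15 t16 t17 t18 t19 Ef cn qn qc nwb tbb inv => // f IHf.
move=> c [|p] nw tb t14 t15 t16 t17 t18 t19 Ef cn qn qc nwb tbb inv.
  have [cEn|cNn] := eqVneq c n.
    budget (3 + b); jumpeq; add; jumplt; rewrite cEn addn1 ltnSn.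
    by apply: K => //; apply: refining_end; rewrite -cEn; exact: inv.
  have {cNn} cn' : c < n by rewrite ltn_neqAle cNn.
  rewrite potential_letter // in Ef *.
  budget (6 + (potential c.+1 (last_occ c.+1 n) * 23 + 3 + b)).
  jumpeq; add; jumplt; rewrite addn1 ltnNge cn' /=.
  add; read; jump; rewrite hdP.
  by apply: IHf => //; [exact: last_occ_le | exact: letter_last_occ
                       | exact: refining_letter].
have lp := qc _ erefl; rewrite -{}lp in Ef cn inv *; set c' := letter p in cn *.
rewrite potential_next // -/c' in Ef *.
have lo : last_occ c' p <= n by rewrite (leq_trans (last_occ_le _ _)) // ltnW.
budget (23 + (potential c' (last_occ c' p) * 23 + 3 + b)).
jumpeq; jumplt.
(* The common end of all branches; [bb] absorbs the budget that a branch leaves over. *)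
have tail bb nw' tb' u14 u15 u16 u17 u18 u19 : 
    bounded nw' -> bounded tb' -> refining m nm c' (last_occ c' p) nw' tb' ->
    reach (3 + bb + (potential c' (last_occ c' p) * 23 + 3 + b))
      (mach Lskip m.+1 c' p.+1 u14 u15 u16 u17 u18 u19 hd nx nm nw' tb' ls o) Q.
  move=> nwb' tbb' inv'; budget (3 + (potential c' (last_occ c' p) * 23 + 3 + b)).
  add; read; jump; rewrite nxP //.
  by apply: IHf => //; exact: letter_last_occ.
(* No factor of length [m + 1] ends at a position [p < m], so the cell is skipped. *)
have [pm|mp] := ltnP p.+1 m.+1.
  apply: (tail 18) => //; apply: refining_ext inv => // x xm.
  rewrite visited_last_occ // => /orP[//|/eqP xp]; lia.
have [i pE] : exists i, p = i + m by exists (p - m); lia.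
subst p; sub; have -> : (i + m).+1 - m.+1 = i by lia.
have im : i + m < n := qn.
have a_le := nmb i; have j_le := tbb (nm i).
add; read; add; read; add; jumplt.
have := refining_step nmP im inv; rewrite -/c'; set j := tb (nm i).
set ok := [&& _, _ & _] => inv'.
have set_name nw' tb' bb u15 u16 u18 u19 (j' := if ok then j else i) :
    nw' = nw -> tb' = (if ok then tb else [eta tb with nm i |-> i]) ->
    reach (5 + bb + (potential c' (last_occ c' (i + m)) * 23 + 3 + b))
      (mach Lset m.+1 c' (i + m).+1 i u15 u16 j' u18 u19 hd nx nm nw' tb' ls o) Q.
  move=> -> ->; have j'_le : j' <= n by rewrite /j'; case: ifP; lia.
  budget (2 + (3 + bb + (potential c' (last_occ c' (i + m)) * 23 + 3 + b))).
  add; write; apply: tail => //.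
    by apply: bounded_upd.
  by case: ifP => // _; apply: bounded_upd => //; lia.
have fresh bb u18 u19 : ok = false ->
    reach (7 + bb + (potential c' (last_occ c' (i + m)) * 23 + 3 + b))
      (mach Lfresh m.+1 c' (i + m).+1 i (nm i) (5 * N + nm i) j u18 u19
        hd nx nm nw tb ls o) Q.
  move=> okE; budget
    (2 + (5 + bb + (potential c' (last_occ c' (i + m)) * 23 + 3 + b))).
  write; move_reg.
  have := @set_name nw [eta tb with nm i |-> i] bb (nm i) (5 * N + nm i) u18 u19.
  by rewrite /= okE; apply.
(* The three tests of [ok] follow in order: range, last letter, prefix name. *)
case: ltnP => jn; first by apply: (fresh 7); rewrite /ok; lia.
sub; have -> : j + m.+1 - 1 = j + m by lia.
read_at 0 (j + m); jumpeq; case: eqP => jl; last first.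
  jump; apply: (fresh 3); rewrite /ok; lia.
add; read; jumpeq; case: eqP => jnm; last first.
  apply: (fresh 1); rewrite /ok; lia.
have okE : ok by rewrite /ok jl jnm !eqxx andbT; lia.
have := @set_name nw tb 3 (nm i) (5 * N + nm i) (nm j) t19.
by rewrite /= okE; apply.
Qed.

(** * Windows of distinct blocks in a residue class *)

Definition distinct L (f : nat -> nat) r u v := forall s t,
  u <= s -> s < t -> t < v -> f (s * L + r) <> f (t * L + r).

Definition anti_power_factor L x := x + k * L <= n /\
  forall s t, s < t < k -> factor S L (x + s * L) != factor S L (x + t * L).

(* Invariant after the first [v] positions of the residue class [r]; the window
   starts at the position number [u] of the class. *)
Record scanning L (f : nat -> nat) (locs0 : seq (nat * nat)) r v u
    (nm ls : nat -> nat) (locs : seq (nat * nat)) : Prop := Scanning {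
  scanning_window : forall u', distinct L f r u' v <-> u <= u';
  scanning_old : forall x, x + L <= n -> x %% L < r -> nm x = f x;
  scanning_new : forall t, t < v -> nm (t * L + r) = f (t * L + r);
  scanning_last : forall t, t < v -> exists t', [/\ t <= t' < v,
    ls (f (t * L + r)) = t' * L + r & f (t' * L + r) = f (t * L + r)];
  scanning_locs : forall l, l \in locs <-> l \in locs0 \/
    exists x, [/\ l = (x.+1, x + k * L), anti_power_factor L x &
      x %% L < r \/ exists2 t, t + k <= v & x = t * L + r]
}.

Lemma scanning_start L f locs0 nm ls :
  scanning L f locs0 0 0 0 nm ls locs0.
Proof.
split=> // l; split=> [|[//|[x [_ _ [//|[t]]]]]]; first by left.
lia.
Qed.

(** The bound on [n] says that block [v] does not fit, so class [r] is exhausted and joins the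
    finished ones. *)
Lemma scanning_residue L f locs0 r v u nm ls locs :
  r < L -> n < v * L + r + L ->
  scanning L f locs0 r v u nm ls locs ->
  scanning L f locs0 r.+1 0 0 nm ls locs.
Proof.
move=> rL nv [Hw Ho Hn Hl Hc]; have L0 : 0 < L := leq_ltn_trans (leq0n r) rL.
split=> // [x xn|l].
  rewrite ltnS leq_eqVlt => /orP[/eqP xr|]; last exact: Ho.
  rewrite (divn_eq x L) xr in xn *; apply: Hn.
  by rewrite -(ltn_pmul2r L0); nia.
rewrite Hc; split=> -[h|[x [lE ax h]]]; try by left.
  right; exists x; split=> //; left; case: h => [/ltnW //|[t _ ->]].
  by rewrite modnMDl modn_small.
right; exists x; split=> //; case: h => [|[t]]; last by lia.
rewrite ltnS leq_eqVlt => /orP[/eqP xr|]; last by left.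
right; exists (x %/ L); last by rewrite -xr -divn_eq.
have := ax.1; rewrite {1}(divn_eq x L) xr => h.
by rewrite -ltnS -(ltn_pmul2r L0); nia.
Qed.

Lemma distinct_anti_power L f r t : 0 < L -> names L f -> (t + k) * L + r <= n ->
  distinct L f r t (t + k) <-> anti_power_factor L (t * L + r).
Proof.
move=> L0 fP tn.
have bnd s : s < t + k -> s * L + r + L <= n.
  move=> h; have : s.+1 * L <= (t + k) * L by rewrite leq_mul2r h orbT.
  by rewrite mulSn; lia.
split=> [D|[_ D] s s' ts ss' sk].
  split; first by rewrite mulnDl in tn; lia.
  move=> s s' /andP[ss' sk]; rewrite -!addnA ![r + _]addnC !addnA -!mulnDl.
  rewrite -fP; [|apply: bnd; lia|apply: bnd; lia].
  by apply/eqP/D; lia.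
have := D (s - t) (s' - t); rewrite -!addnA ![r + _]addnC !addnA -!mulnDl.
rewrite !subnKC //; [|lia]; rewrite -fP; [|apply: bnd; lia|apply: bnd; lia].
by move=> h; apply/eqP/h; lia.
Qed.

(** An entry [p] that passes [ok] lies in the scanned part of the class, where [nm] agrees with [f];
    it is thus the true latest occurrence. Only an anti-power ending with block [v] can be new. *)
Lemma scanning_step L f locs0 r v u nm ls locs (i := v * L + r) (p := ls (f i))
    (nm' := [eta nm with i |-> f i])
    (ok := [&& p < i, p %% L == r & nm' p == f i])
    (lw := if ok && (u * L + r <= p + L) then p + L else u * L + r)
    (l := (i + L - k * L + 1, i + L)) :
  0 < L -> r < L -> names L f -> i + L <= n ->
  scanning L f locs0 r v u nm ls locs ->
  exists2 u', lw = u' * L + r & scanning L f locs0 r v.+1 u' nm'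
    [eta ls with f i |-> i] (if lw + k * L <= i + L then rcons locs l else locs).
Proof.
move=> L0 rL fP iL [Hw Ho Hn Hl Hc].
have posI s t : s * L + r = t * L + r -> s = t.
  by move/addIn/eqP; rewrite eqn_pmul2r // => /eqP.
have pos_lt s t : (s * L + r < t * L + r) = (s < t).
  by rewrite ltn_add2r ltn_pmul2r.
have [u' [lwE Hu']] : exists u', lw = u' * L + r /\
    forall x, u' <= x <-> u <= x /\
      forall s, x <= s -> s < v -> f (s * L + r) <> f i.
  rewrite /lw.
  (* If the test fails, no earlier block of the class has this name, for otherwise [Hl] would make
     the entry pass. *)
  case: (boolP ok) => [/and3P[pi /eqP pr /eqP nmp]|okN] /=; last first.
    exists u; split=> // x; split=> [ux|[]//]; split=> // s _ sv fs.
    have [t' [/andP[_ tv] lE fE]] := Hl s sv; rewrite fs in lE fE.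
    case/negP: okN; rewrite /ok /p lE pos_lt tv modnMDl modn_small // eqxx /=.
    by rewrite /nm' /=; case: ifP => // _; rewrite Hn // fE.
  set t := p %/ L; have pE : p = t * L + r by rewrite -pr -divn_eq.
  have tv : t < v by rewrite -pos_lt -pE.
  have fp : f (t * L + r) = f i.
    by rewrite -Hn // -nmp -pE /nm' /= (ltn_eqF pi).
  have last s : s < v -> f (s * L + r) = f i -> s <= t.
    move=> sv fs; have [t' [/andP[st _] lE _]] := Hl s sv.
    by move: lE; rewrite fs -/p pE => /posI ->.
  have -> : p + L = t.+1 * L + r by rewrite pE mulSn; lia.
  (* Just past block [t], the latest with this name, unless the window already starts later. *)
  exists (maxn u t.+1); split.
    by rewrite leq_add2r leq_pmul2r //; case: leqP.
  move=> x; rewrite geq_max; split=> [/andP[ux tx]|[-> h]].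
    by split=> // s xs sv /(last s sv); rewrite leqNgt (leq_trans tx).
  by rewrite /= ltnNge; apply/negP => xt; exact: (h t).
have Hw' x : distinct L f r x v.+1 <-> u' <= x.
  rewrite Hu' -Hw; split=> [D|[D h] s t xs st]; first split.
  - by move=> s t xs st tv; apply: D => //; exact: leqW.
  - by move=> s xs sv; apply: D.
  - by rewrite ltnS leq_eqVlt => /orP[/eqP tE|]; [subst t; apply: h | exact: D].
exists u' => //; split=> //.
- move=> x xn xr /=; case: eqP => [->//|_]; exact: Ho.
- move=> t; rewrite ltnS leq_eqVlt /= => /orP[/eqP->|tv]; first by rewrite eqxx.
  by case: eqP => [->//|_]; exact: Hn.
- move=> t tv /=; case: eqP => [fE|fN].
    by exists v; rewrite fE leqnn andbT -ltnS tv.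
  have {}tv : t < v.
    by move: tv; rewrite ltnS leq_eqVlt => /orP[/eqP tE|//]; rewrite tE in fN.
  have [t' [/andP[tt' tv'] -> fE]] := Hl t tv.
  by exists t'; rewrite tt' ltnS ltnW.
have vL : v.+1 * L + r = i + L by rewrite mulSn /i; lia.
(* An anti-power ending with block [v] must start at block [v + 1 - k], and exists iff the window
   reaches back that far. *)
have emit : lw + k * L <= i + L <-> exists2 t, t + k = v.+1 & u' <= t.
  rewrite lwE -vL addnAC leq_add2r -mulnDl leq_pmul2r //; split=> [h|[t <- ut]].
    by exists (v.+1 - k); lia.
  by rewrite leq_add2r.
have locE t : t + k = v.+1 -> l = ((t * L + r).+1, t * L + r + k * L).
  by move=> tk; rewrite /l -vL -tk mulnDl; congr pair; lia.
have apE t : t + k = v.+1 -> u' <= t <-> anti_power_factor L (t * L + r).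
  move=> tk; rewrite -Hw' -tk; apply: distinct_anti_power => //.
  by rewrite tk vL.
move=> l'; have: l' \in (if lw + k * L <= i + L then rcons locs l else locs) <->
    l' \in locs \/ l' = l /\ lw + k * L <= i + L.
  case: ifP => _; last by split=> [|[|[]]] //; left.
  rewrite mem_rcons inE; split=> [/orP[/eqP|]|[|[->]]]; try by [left | right].
    by move=> ->; rewrite orbT.
  by rewrite eqxx.
move=> ->; rewrite Hc emit; split.
- case=> [[|[x [lE ax h]]]|[-> [t tk ut]]]; first by left.
    right; exists x; split=> //; case: h => [|[t tk]]; first by left.
    by right; exists t => //; exact: leqW.
  right; exists (t * L + r); split; [exact: locE | exact/apE |].
  by right; exists t; rewrite // tk.
- case=> [|[x [lE ax [xr|[t tk xE]]]]]; first by do 2 left.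
    by left; right; exists x; split=> //; left.
  move: tk; rewrite leq_eqVlt => /orP[/eqP tk|tk]; last first.
    by left; right; exists x; split=> //; right; exists t.
  right; split; first by rewrite lE xE -locE.
  by exists t => //; apply/apE => //; rewrite -xE.
Qed.

Lemma encode_rcons locs l :
  encode (rcons locs l) = rcons (rcons (encode locs) l.1) l.2.
Proof. by rewrite /encode map_rcons flatten_rcons -!cats1 -catA. Qed.

(* Every class has at most [n %/ L] positions. *)
Let scan_cost L r v := (n %/ L - v) + (L - r.+1) * (n %/ L) + (L - r).

Lemma scan_loop b Q L r v u f locs0 nm tb ls locs t15 t16 t17 t18 t19 hd nx :
  r < L -> v * L + r <= n -> L * k <= n -> u <= v -> names L f ->
  bounded f -> bounded nm -> bounded ls ->
  scanning L f locs0 r v u nm ls locs ->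
  (forall x y nm ls locs t14 t15 t16 t17 t18 t19,
     names L nm -> bounded nm -> bounded ls ->
     (forall l, l \in locs <-> l \in locs0 \/
        exists2 x, l = (x.+1, x + k * L) & anti_power_factor L x) ->
     reach b (mach Llen L x y t14 t15 t16 t17 t18 t19
                hd nx nm f tb ls (encode locs)) Q) ->
  reach (scan_cost L r v * 29 + b)
    (mach Lpos L r (v * L + r) (u * L + r) t15 t16 t17 t18 t19
       hd nx nm f tb ls (encode locs)) Q.
Proof.
move=> rL vn Lk uv fP fb nmb lsb inv K.
have L0 : 0 < L := leq_ltn_trans (leq0n r) rL.
have [e Ee] := ubnP (scan_cost L r v).
elim: e r v u nm ls locs t15 t16 t17 t18 t19 Ee rL vn uv nmb lsb inv => // e IHe.
move=> r v u nm ls locs t15 t16 t17 t18 t19 Ee rL vn uv nmb lsb inv.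
have Ln : L <= n by rewrite (leq_trans _ Lk) // leq_pmulr // ltnW.
have uL : u * L <= v * L by rewrite leq_mul2r uv orbT.
have [vN|nv] := leqP (v * L + r + L) n; last first.
  have rest : scan_cost L r v = (L - r.+1) * (n %/ L) + (L - r) + (n %/ L - v).
    by rewrite /scan_cost; lia.
  have inv' := scanning_residue rL nv inv.
  have [rE|rN] := eqVneq r.+1 L.
    budget (4 + b).
    add; jumplt; rewrite nv; add; jumpeq; rewrite addn1 rE eqxx.
    (* Every residue is below [r.+1], so the overwritten array agrees with [f] wherever a block fits
       and names length [L]. *)
    case: inv' => _ Ho _ _ Hc; have r_lt x : x %% L < r.+1 by rewrite rE ltn_mod.
    apply: K => // [i j iL jL|l]; first by rewrite !Ho // fP.
    rewrite Hc; split=> -[|[x]]; try by left.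
      by case=> lE ax _; right; exists x.
    by move=> lE ax; right; exists x; split=> //; left.
  have {rN} rL' : r.+1 < L by rewrite ltn_neqAle rN.
  have costE : scan_cost L r v = scan_cost L r.+1 0 + 1 + (n %/ L - v).
    by rewrite rest /scan_cost subn0 -subSS (subSn rL') mulSn; lia.
  rewrite costE in Ee *.
  budget (7 + (scan_cost L r.+1 0 * 29 + b)).
  add; jumplt; rewrite nv; add; jumpeq; rewrite addn1 (ltn_eqF rL').
  do 2 move_reg; jump.
  by apply: (IHe r.+1 0 0) => //; lia.
have vq : v < n %/ L by rewrite leq_divRL // mulSn; lia.
have costE : scan_cost L r v = (scan_cost L r v.+1).+1.
  by rewrite /scan_cost; lia.
rewrite costE in Ee *.
set X := scan_cost L r v.+1 * 29 + b.
budget (29 + X).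
have [u' lwE inv'] := scanning_step L0 rL fP vN inv.
move: lwE inv'; set i := v * L + r in vN vn *; set p := ls (f i).
set nm' : nat -> nat := [eta nm with i |-> f i]; set ok := [&& _, _ & _].
set ls' : nat -> nat := [eta ls with f i |-> i]; set lw := if _ then _ else _.
set locs' := if _ then _ else _.
move=> lwE inv'; have a_le := fb i; have p_le : p <= n := lsb _.
have nmb' : bounded nm' by exact: bounded_upd.
have i_le : i <= n by lia.
have lsb' : bounded ls' by exact: bounded_upd.
(* The empty window starting at [v.+1] is distinct, which bounds [u']. *)
have u'v : u' <= v.+1.
  rewrite -(scanning_window inv') => s t vs st.
  by rewrite ltnNge (leq_trans vs) ?(ltnW st).
have u'L : u' * L <= v.+1 * L by rewrite leq_mul2r u'v orbT.
have viL : v.+1 * L + r = i + L by rewrite mulSn /i; lia.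
have test bb u16 u17 u18 u19 lw' : lw' = lw -> reach (8 + bb + X)
    (mach Ltest L r i lw' (i + L) u16 u17 u18 u19
      hd nx nm' f tb ls' (encode locs)) Q.
  move=> ->.
  have next_pos z18 : reach (2 + X)
      (mach Lnext L r i lw (i + L) u16 u17 z18 u19
        hd nx nm' f tb ls' (encode locs')) Q.
    move_reg; jump; rewrite -viL lwE.
    by apply: IHe; rewrite ?viL.
  have lw_le : lw + L * k <= 2 * n by rewrite lwE; lia.
  budget (8 + X); add; jumplt; case: ltnP => h.
    budget (2 + X); have := next_pos (lw + L * k).
    by rewrite /locs' (mulnC k) leqNgt h.
  sub; add; output; output; have := next_pos (i + L - L * k + 1).
  by rewrite /locs' (mulnC k) h encode_rcons.
add; jumplt; rewrite ltnNge vN /=.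
add; read; add; write; add; read; write; rewrite -/p -/nm' -/ls'.
jumplt; case: ltnP => pi; last first.
  by jump; apply: (test 10); rewrite /lw /ok ltnNge pi.
apply: reach_mod; [reflexivity|bound|next]; jumpeq; case: eqP => pr; last first.
  by jump; apply: (test 8); rewrite /lw /ok (introF eqP pr) andbF.
add; read; jumpeq; case: eqP => pa; last first.
  by jump; apply: (test 5); rewrite /lw /ok (introF eqP pa) !andbF.
have okE : ok by rewrite /ok pi pr pa !eqxx.
add; jumplt; case: ltnP => pu.
  by apply: (test 4); rewrite /lw okE leqNgt pu.
by move_reg; apply: (test 3); rewrite /lw okE pu.
Qed.

(** * The loop over anti-periods and its total cost *)

Definition reports_anti_powers s := halted antipower_prog s /\
  exists2 locs, output s = encode locs &
    forall i j, (i, j) \in locs <-> anti_power_at k S i j.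

Lemma length_loop m x y t14 t15 t16 t17 t18 t19 hd nx nm nw tb ls locs :
  m * k <= n -> lists_upto n hd nx -> names m nm ->
  bounded nm -> bounded nw -> bounded tb -> bounded ls ->
  (forall l, l \in locs <-> exists L x,
     [/\ 0 < L <= m, l = (x.+1, x + k * L) & anti_power_factor L x]) ->
  reach ((n %/ k - m) * (110 * n) + 3)
    (mach Llen m x y t14 t15 t16 t17 t18 t19 hd nx nm nw tb ls (encode locs))
    reports_anti_powers.
Proof.
move=> mk lists; have [e Ee] := ubnP (n %/ k - m).
elim: e m x y t14 t15 t16 t17 t18 t19 nm nw tb ls locs Ee mk => // e IHe.
move=> m x y t14 t15 t16 t17 t18 t19 nm nw tb ls locs Ee mk.
move=> nmP nmb nwb tbb lsb locsP.
have mn : m <= n by rewrite (leq_trans _ mk) // leq_pmulr // ltnW.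
have [m'k|m'k] := ltnP n (m.+1 * k).
  apply: (@reach_le _ _ 3); last exact: leq_addl.
  add; add; rewrite addn1 -mulSnr; jumplt; rewrite m'k.
  apply: reach_done; split=> //; exists locs => // i j.
  rewrite anti_power_atP // size_S locsP; split=> [[L [z]]|[L [z]]].
    by case=> /andP[L0 _] [-> ->] [zn D]; exists L, z.
  (* An anti-power of anti-period [L] needs [k * L <= n < m.+1 * k], hence [L <= m]. *)
  case=> L0 -> -> zn D; exists L, z; split=> //; rewrite L0 /=.
  rewrite -ltnS -(ltn_pmul2r (ltnW k_gt1)) (leq_ltn_trans _ m'k) //.
  by rewrite mulnC (leq_trans (leq_addl _ _) zn).
have mq : m < n %/ k by rewrite leq_divRL // ltnW.
have m'n : m < n by rewrite (leq_trans _ m'k) // leq_pmulr // ltnW.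
have cost1 : potential 0 0 <= 2 * n.
  by rewrite /potential take0 /=; have := count_size [eta leq 1] S; lia.
have cost2 : scan_cost m.+1 0 0 <= 2 * n.
  rewrite /scan_cost !subn0 -mulSn subSS subn0.
  by have := leq_divM n m.+1; lia.
set X := (n %/ k - m.+1) * (110 * n) + 3.
(* One length costs at most [46 * n + 58 * n + 11] steps, which is at most [110 * n] as [n >= 2]. *)
have budgetE : 5 + (potential 0 0 * 23 + 3 + (3 + (scan_cost m.+1 0 0 * 29 + X)))
    <= (n %/ k - m) * (110 * n) + 3.
  by rewrite -(subnSK mq) mulSn /X; lia.
apply: (reach_le _ budgetE).
add; add; rewrite addn1 -mulSnr; jumplt; rewrite ltnNge m'k /=.
do 2 move_reg.
apply: refine_loop => //; first exact: refining_start.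
move=> nw' tb' x' y' u14 u15 u16 u17 u18 u19 nw'P nw'b tb'b.
do 3 move_reg.
apply: (scan_loop (v := 0) (u := 0)) => //; first exact: scanning_start.
move=> x'' y'' nm'' ls'' locs'' z14 z15 z16 z17 z18 z19 nmP'' nmb'' lsb'' locsP''.
apply: IHe => //; first lia.
move=> l; rewrite locsP'' locsP; split.
  case=> [[L [z [/andP[L0 Lm] lE ax]]]|[z lE ax]].
    by exists L, z; split=> //; rewrite L0 leqW.
  by exists m.+1, z; rewrite leqnn.
case=> L [z [/andP[L0]]]; rewrite leq_eqVlt => /orP[/eqP ->|Lm] lE ax.
  by right; exists z.
by left; exists L, z; rewrite L0.
Qed.

Lemma initial_conf : initial n k S =
  conf N 0 [:: n; k; 0; 0; 0; 0; 0; 0; 0; 0; 0; 0; 0; 0; 0; 0; 0; 0; 0; 0]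
    [:: letter; fun=> 0; fun=> 0; fun=> 0; fun=> 0; fun=> 0; fun=> 0] [::].
Proof.
rewrite /initial /conf; congr State; apply: functional_extensionality => a.
  by do 20 case: a => [|a] //; rewrite /= nth_nil.
have [aN|Na] := ltnP a N; first by rewrite divn_small // modn_small.
rewrite nth_default; last by rewrite size_S; lia.
case: (a %/ N) (leq_div2r N Na) => [|c _]; first by rewrite divnn.
by do 6 case: c => [|c] //=; rewrite nth_nil.
Qed.

Lemma reach_report : reach ((n %/ k) * (110 * n) + 9 * n + 12)
  (initial n k S) reports_anti_powers.
Proof.
rewrite initial_conf.
budget (8 + ((n - 0) * 9 + 1 + ((n %/ k - 0) * (110 * n) + 3))).
jumplt; rewrite ltnNge k_le_n /=.
apply: reach_const; [reflexivity|bound|next]; do 6 add.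
have -> : n + 1 = 1 * N by lia.
have -> : 1 * N + 1 * N = 2 * N by lia.
have -> : 2 * N + 1 * N = 3 * N by lia.
have -> : 3 * N + 1 * N = 4 * N by lia.
have -> : 4 * N + 1 * N = 5 * N by lia.
have -> : 5 * N + 1 * N = 6 * N by lia.
have lists0 : lists_upto 0 (fun=> 0) (fun=> 0) by [].
apply: (@build_loop _ _ 0 0) => // hd nx y t14 t15 t16 lists.
apply: (@length_loop 0 0 y t14 t15 t16 0 0 0 hd nx _ _ _ _ [::]) => //.
(* All empty factors are equal, so the zero-filled table names length 0. *)
- by move=> i j _ _; rewrite /factor !take0 !eqxx.
- move=> l; split=> // -[L [x [/andP[L0]]]].
  by rewrite leqn0 => /eqP L00; rewrite L00 in L0.
Qed.

End Machine.

Theorem theorem1 :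
  exists (P : program) (cw ct cs : nat),
  forall (n k w : nat) (S : n.-tuple nat),
    (forall a, a \in S -> 1 <= a <= n) ->
    1 < k ->
    n < 2 ^ w -> k < 2 ^ w -> cw * n <= 2 ^ w ->
    exists (t : nat) (locs : seq (nat * nat)),
      [/\ halted P (run w P (initial n k S) t),
          output (run w P (initial n k S) t) = encode locs,
          forall i j : nat, (i, j) \in locs <-> anti_power_at k S i j,
          t * k <= ct * maxn k (n ^ 2)
        & space w P (initial n k S) t <= cs * n].
Proof.
(* Addresses are at most [6 * (n + 1) + n], below [14 * n], and all register values stay below
   [16 * n]. The time constant is [110 + 9 + 6], where [6] comes from [12 * n <= 6 * n * n]. *)
exists antipower_prog, 16, 125, 14 => n k w S S_letters k1 _ _ nw.
have [kn|nk] := leqP k n.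
  have [t tb [ft [Ht [locs Ho Hl]]]] :=
    reach_report (size_tuple S) S_letters k1 kn nw.
  exists t, locs; split=> //; last by apply/bigmax_leqP => t' _; exact: ft.
  apply: (@leq_trans (125 * n ^ 2)); last by rewrite leq_mul2l leq_maxr orbT.
  apply: (leq_trans (leq_mul tb (leqnn k))); rewrite -mulnn.
  have kq : n %/ k * k * (110 * n) <= n * (110 * n).
    by rewrite leq_mul2r leq_divM orbT.
  have kn' : (9 * n + 12) * k <= (9 * n + 12) * n by rewrite leq_mul2l kn orbT.
  have n2 : 12 * n <= 6 * n * n by rewrite leq_mul2r; lia.
  by lia.
(* Here [n < k]: the first instruction jumps to [Halt], and [k] nonempty blocks do not fit into the
   string. *)
exists 1, [::]; rewrite /run /= /step /fetch /= nk; split=> //; last first.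
- by rewrite /space big_ord_recl big_ord0.
- by rewrite mul1n (leq_trans (leq_maxl k (n ^ 2))) // leq_pmull.
move=> i j; split=> // /(anti_power_atP _ _ _ k1)[L [x [L0 _ -> jn _]]].
by move: jn; rewrite size_tuple; have := leq_pmulr k L0; lia.
Qed.
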